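(* Let $\mathbb{K}$ be a field, $R=\mathbb{K}[x_1,x_2,x_3]$, and let $\phi:\{1,2,3\}\to\mathbb{N}$ be an almost linear degree function. If $\operatorname{char}(\mathbb{K})=0$ or $\operatorname{char}(\mathbb{K})>\phi(1)+\phi(2)+\phi(3)-2$, then the Hilbert series $P(R/J_\phi,t)$ equals $$\frac{1-3t^{\phi(1)}-3t^{2\phi(2)}-t^{3\phi(3)}+3t^{2\phi(2)+\phi(3)}+3t^{\phi(1)+2\phi(3)}+6t^{\phi(1)+\phi(2)}-6t^{\phi(1)+\phi(2)+\phi(3)}}{(1-t)^3}.$$
   Context: $\mathbb{N}$ denotes the positive integers. A function $\phi:\{1,2,3\}\to\mathbb{N}$ is an almost linear degree function if there is $k\in\mathbb{N}$ such that $\phi(r)-\phi(r+1)\in\{k,k+1\}$ for $r=1,2$. The ideal $J_\phi\subseteq R=\mathbb{K}[x_1,x_2,x_3]$ is $$J_\phi=\langle x_1^{\phi(1)},x_2^{\phi(1)},x_3^{\phi(1)},(x_1+x_2)^{2\phi(2)},(x_1+x_3)^{2\phi(2)},(x_2+x_3)^{2\phi(2)},(x_1+x_2+x_3)^{3\phi(3)}\rangle.$$ For a homogeneous ideal $I\subseteq R$ (standard grading), $P(R/I,t)=\sum_{j\ge 0}\dim_{\mathbb{K}}(R/I)_j\,t^j$. *)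

(* Defs.v *)
From Stdlib Require Import ClassicalEpsilon.
From HB Require Import structures.
From mathcomp Require Import all_boot all_order all_algebra.
From mathcomp Require Import mpoly.

Set Implicit Arguments.
Unset Strict Implicit.
Unset Printing Implicit Defensive.

Import GRing.Theory.
Local Open Scope ring_scope.

(* A function on {1,2,3} is encoded as [phi : 'I_3 -> nat], with [phi i]
   standing for $\phi(i+1)$; likewise ['X_i] is $x_{i+1}$.  The differences
   are taken in [int], and $\mathbb{N}$ is the set of positive integers. *)
Definition almost_linear (phi : 'I_3 -> nat) : Prop :=
  (forall r : 'I_3, (0 < phi r)%N) /\
  exists2 k : nat, (0 < k)%N &
    ((phi 0)%:Z - (phi 1)%:Z \in [:: k%:Z; k.+1%:Z]) /\
    ((phi 1)%:Z - (phi 2)%:Z \in [:: k%:Z; k.+1%:Z]).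

Definition in_ideal_gen (R : comNzRingType) (gs : seq R) (p : R) : Prop :=
  exists c : 'I_(size gs) -> R, p = \sum_(i < size gs) c i * gs`_i.

Definition J_gens (K : fieldType) (phi : 'I_3 -> nat) : seq {mpoly K[3]} :=
  let x (i : 'I_3) : {mpoly K[3]} := 'X_i in
  [:: x 0 ^+ phi 0; x 1 ^+ phi 0; x 2 ^+ phi 0;
      (x 0 + x 1) ^+ (2 * phi 1%R); (x 0 + x 2) ^+ (2 * phi 1%R);
      (x 1 + x 2) ^+ (2 * phi 1%R);
      (x 0 + x 1 + x 2) ^+ (3 * phi 2%R)].
Arguments J_gens : clear implicits.

Definition J_ideal (K : fieldType) (phi : 'I_3 -> nat) : {mpoly K[3]} -> Prop :=
  in_ideal_gen (J_gens K phi).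
Arguments J_ideal : clear implicits.

(* For a homogeneous ideal [I] of R = K[x_1,...,x_n], the graded piece
   (R/I)_j is the image of R_j in R/I.  A K-basis of it is given by
   forms of degree [j] whose classes modulo [I] span it and are linearly
   independent. *)
Definition graded_quotient_basis (n : nat) (K : fieldType)
    (I : {mpoly K[n]} -> Prop) (j d : nat) (b : 'I_d -> {mpoly K[n]}) : Prop :=
  [/\ forall i, b i \is j.-homog,
      forall p, p \is j.-homog ->
        exists c : 'I_d -> K, I (p - \sum_(i < d) c i *: b i)
    & forall c : 'I_d -> K, I (\sum_(i < d) c i *: b i) -> forall i, c i = 0].

Definition graded_quotient_dim_spec (n : nat) (K : fieldType)
    (I : {mpoly K[n]} -> Prop) (j d : nat) : Prop :=
  exists b : 'I_d -> {mpoly K[n]}, graded_quotient_basis I j b.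

(* The number selected exists and is unique when [I] is an ideal: see
   [graded_quotient_dimP] and [graded_quotient_dim_uniq] below. *)
Definition graded_quotient_dim (n : nat) (K : fieldType)
    (I : {mpoly K[n]} -> Prop) (j : nat) : nat :=
  epsilon (inhabits 0%N) (graded_quotient_dim_spec I j).

(* Formal power series over [R] are coefficient sequences [nat -> R]. *)
Definition fps (R : Type) : Type := nat -> R.

Definition poly_fps (R : nzRingType) (p : {poly R}) : fps R := fun j => p`_j.

Definition fps_mul (R : nzRingType) (a b : fps R) : fps R :=
  fun j => \sum_(i < j.+1) a i * b (j - i)%N.

(* Long division: [fps_quot_seq a b m] lists the first [m] coefficients of
   a / b.  When [b 0] is a unit, [fps_div a b] is the unique power series
   whose product with [b] is [a]: see [fps_divK] and [fps_div_uniq]. *)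
Fixpoint fps_quot_seq (R : comUnitRingType) (a b : fps R) (m : nat) : seq R :=
  if m is m'.+1 then
    let s := fps_quot_seq a b m' in
    rcons s ((a m' - \sum_(i < m') s`_i * b (m' - i)%N) / b 0%N)
  else [::].

Definition fps_div (R : comUnitRingType) (a b : fps R) : fps R :=
  fun j => (fps_quot_seq a b j.+1)`_j.

Definition hilbert_series (n : nat) (K : fieldType)
    (I : {mpoly K[n]} -> Prop) : fps int :=
  fun j => (graded_quotient_dim I j)%:Z.

Definition J_numerator (phi : 'I_3 -> nat) : {poly int} :=
  let f1 := phi 0 in let f2 := phi 1 in let f3 := phi 2 in
  1 - 3%:R * 'X^f1 - 3%:R * 'X^(2 * f2) - 'X^(3 * f3)
  + 3%:R * 'X^(2 * f2 + f3) + 3%:R * 'X^(f1 + 2 * f3)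
  + 6%:R * 'X^(f1 + f2) - 6%:R * 'X^(f1 + f2 + f3).

Section Facts.

Lemma size_fps_quot_seq (R : comUnitRingType) (a b : fps R) m :
  size (fps_quot_seq a b m) = m.
Proof. by elim: m => //= m IH; rewrite size_rcons IH. Qed.

Lemma nth_fps_quot_seq (R : comUnitRingType) (a b : fps R) m j :
  (j < m)%N -> (fps_quot_seq a b m)`_j = fps_div a b j.
Proof.
elim: m => // m IH; rewrite ltnS leq_eqVlt => /orP[/eqP-> //|ltjm].
by rewrite /= nth_rcons size_fps_quot_seq ltjm IH.
Qed.

Lemma fps_divE (R : comUnitRingType) (a b : fps R) j :
  fps_div a b j = (a j - \sum_(i < j) fps_div a b i * b (j - i)%N) / b 0%N.
Proof.
rewrite {1}/fps_div /= nth_rcons size_fps_quot_seq ltnn eqxx.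
by under eq_bigr => i _ do rewrite nth_fps_quot_seq //.
Qed.

Lemma fps_divK (R : comUnitRingType) (a b : fps R) :
  b 0%N \is a GRing.unit -> fps_mul (fps_div a b) b =1 a.
Proof.
move=> ub j; rewrite /fps_mul big_ord_recr /= subnn fps_divE divrK //.
by rewrite addrC subrK.
Qed.

Lemma fps_div_uniq (R : comUnitRingType) (a b q : fps R) :
  b 0%N \is a GRing.unit -> fps_mul q b =1 a -> q =1 fps_div a b.
Proof.
move=> ub qb j; elim/ltn_ind: j => j IH.
apply: (mulIr ub); rewrite [RHS]mulrC fps_divE mulrC divrK // -qb /fps_mul.
rewrite big_ord_recr /= subnn.
under [X in _ = _ - X]eq_bigr => i _ do rewrite -IH //.
by rewrite addrAC subrr add0r.
Qed.

Lemma in_ideal_gen0 (R : comNzRingType) (gs : seq R) : in_ideal_gen gs 0.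
Proof. by exists (fun=> 0); rewrite big1 // => i _; rewrite mul0r. Qed.

Lemma in_ideal_genD (R : comNzRingType) (gs : seq R) p q :
  in_ideal_gen gs p -> in_ideal_gen gs q -> in_ideal_gen gs (p + q).
Proof.
move=> [c ->] [e ->]; exists (fun i => c i + e i).
by rewrite -big_split; apply: eq_bigr => i _; rewrite mulrDl.
Qed.

Lemma in_ideal_genM (R : comNzRingType) (gs : seq R) r p :
  in_ideal_gen gs p -> in_ideal_gen gs (r * p).
Proof.
move=> [c ->]; exists (fun i => r * c i).
by rewrite mulr_sumr; apply: eq_bigr => i _; rewrite mulrA.
Qed.

Definition ideal_axioms (R : comNzRingType) (I : R -> Prop) : Prop :=
  [/\ I 0, forall p q, I p -> I q -> I (p + q)
    & forall r p, I p -> I (r * p)].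

Lemma in_ideal_gen_ideal (R : comNzRingType) (gs : seq R) :
  ideal_axioms (in_ideal_gen gs).
Proof.
by split; [exact: in_ideal_gen0 | exact: in_ideal_genD | exact: in_ideal_genM].
Qed.

Variables (n : nat) (K : fieldType) (I : {mpoly K[n]} -> Prop).
Hypothesis idI : ideal_axioms I.

Let I0 : I 0. Proof. by case: idI. Qed.
Let ID p q : I p -> I q -> I (p + q). Proof. by case: idI => _ h _; apply: h. Qed.
Let IZ (a : K) p : I p -> I (a *: p).
Proof. by case: idI => _ _ h Ip; rewrite -mul_mpolyC; apply: h. Qed.
Let Isum m (F : 'I_m -> {mpoly K[n]}) :
  (forall i, I (F i)) -> I (\sum_(i < m) F i).
Proof. by move=> IF; apply: (big_ind I). Qed.

Let free_le d e (b : 'I_d -> {mpoly K[n]}) (g : 'I_e -> {mpoly K[n]}) :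
  (forall c : 'I_d -> K, I (\sum_(i < d) c i *: b i) -> forall i, c i = 0) ->
  (forall i, exists c : 'I_e -> K, I (b i - \sum_(k < e) c k *: g k)) ->
  (d <= e)%N.
Proof.
move=> fr sp; pose A i := epsilon (inhabits (fun _ : 'I_e => (0 : K)))
  (fun c => I (b i - \sum_(k < e) c k *: g k)).
have AP i : I (b i - \sum_(k < e) A i k *: g k).
  by apply: epsilon_spec (sp i).
pose M := \matrix_(i < d, k < e) A i k.
suff /eqP <- : row_free M by exact: rank_leq_col.
apply/inj_row_free => v vM; apply/rowP => i; rewrite mxE.
apply: (fr (fun i => v 0 i)).
rewrite (_ : \sum_(i < d) _ =
  \sum_(i < d) v 0 i *: (b i - \sum_(k < e) A i k *: g k)).
  by apply: Isum => k; apply: IZ.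
under [RHS]eq_bigr => k _ do rewrite scalerBr scaler_sumr.
rewrite big_split /= sumrN exchange_big /= [X in _ - X]big1 ?subr0 // => k _.
under eq_bigr => l _ do rewrite scalerA.
rewrite -scaler_suml (_ : \sum_(l < d) _ = (v *m M) 0 k).
  by rewrite vM mxE scale0r.
by rewrite mxE; apply: eq_bigr => l _; rewrite mxE.
Qed.

Lemma graded_quotient_dim_uniq j d e :
  graded_quotient_dim_spec I j d -> graded_quotient_dim_spec I j e -> d = e.
Proof.
move=> [b [hb sb fb]] [g [hg sg fg]]; apply/eqP; rewrite eqn_leq.
by rewrite (free_le fb (fun i => sg _ (hb i))) (free_le fg (fun i => sb _ (hg i))).
Qed.

Let indep j d := exists2 b : 'I_d -> {mpoly K[n]},
  forall i, b i \is j.-homog &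
  forall c : 'I_d -> K, I (\sum_(i < d) c i *: b i) -> forall i, c i = 0.

Let indep_bound j d : indep j d -> (d <= #|{: 'X_{1..n < j.+1}}|)%N.
Proof.
move=> [b hb fb]; set T : finType := 'X_{1..n < j.+1}.
pose g (k : 'I_#|T|) : {mpoly K[n]} := 'X_[bmnm (enum_val k)].
apply: (free_le (g := g) fb) => i.
exists (fun k => (b i)@_(bmnm (enum_val k))).
rewrite [X in X - _](_ : _ = \sum_k (b i)@_(bmnm (enum_val k)) *: g k).
  by rewrite subrr.
rewrite [LHS](@mpolywE n K j.+1).
  by rewrite (reindex _ (onW_bij _ (enum_val_bij T))).
rewrite msizeE; apply/bigmax_leqP_seq => m hm _.
by rewrite (dhomog_mf (hb i) hm).
Qed.

Lemma graded_quotient_dimP j :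
  graded_quotient_dim_spec I j (graded_quotient_dim I j).
Proof.
apply: epsilon_spec.
have i0 : indep j 0 by exists (fun=> 0) => [[]|c _ []].
pose N := #|{: 'X_{1..n < j.+1}}|.
have [d id imax] : exists2 d, indep j d & ~ indep j d.+1.
  apply: NNPP => H.
  have ind d : indep j d.
    elim: d => // d IH; apply: NNPP => nd; apply: H; by exists d.
  by have := indep_bound (ind N.+1); rewrite ltnn.
case: id => b hb fb; exists d, b; split=> // p hp; apply: NNPP => nsp.
apply: imax; exists (fun i => if unlift ord_max i is Some k then b k else p).
  by move=> i; case: unliftP.
move=> c; rewrite big_ord_recr /= unlift_none.
have E (i : 'I_d) : unlift ord_max (widen_ord (leqnSn d) i) = Some i.
  rewrite (_ : widen_ord _ _ = lift ord_max i) ?liftK //.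
  by apply: val_inj; rewrite /= /bump leqNgt ltn_ord.
under eq_bigr => i _ do rewrite E.
move=> Ic; have c0 : c ord_max = 0.
  apply/eqP/negPn/negP => nz; apply: nsp.
  exists (fun i => - (c ord_max)^-1 * c (widen_ord (leqnSn d) i)).
  have := IZ (c ord_max)^-1 Ic.
  rewrite scalerDr scalerA mulVf // scale1r addrC scaler_sumr -sumrN.
  by congr (I (_ + _)); apply: eq_bigr => i _; rewrite scalerA mulNr scaleNr opprK.
move: Ic; rewrite c0 scale0r addr0 => Ic i.
case: (unliftP ord_max i) => [k ->|-> //].
rewrite (_ : lift _ _ = widen_ord (leqnSn d) k); first exact: (fb _ Ic).
by apply: val_inj; rewrite /= /bump leqNgt ltn_ord.
Qed.

End Facts.

(* Main.v *)
Require Import Defs.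
From mathcomp Require Import all_boot all_order all_algebra.
From mathcomp Require Import mpoly.
From mathcomp Require Import ring zify.

Set Implicit Arguments.
Unset Strict Implicit.
Unset Printing Implicit Defensive.

Import GRing.Theory.
Local Open Scope ring_scope.

(** Write a, b, c for the three values of phi and u_A for the sum of the
    variables x_i with i in A, so that J is generated by the powers
    u_A ^ (|A| phi(|A|)).  Replacing u_A ^ (|A| d) by the monomial
    (prod_(i in A) x_i) ^ d gives a monomial ideal whose quotient has the
    announced Hilbert series, by inclusion-exclusion over the lcms of its
    generators ([size_standard_monomials], [standard_count_fps]).  So the
    claim is that R/J has, in each degree, as many dimensions as there are
    monomials outside the monomial ideal: the standard monomials.

    Upper bound.  In degrees below the characteristic, the operator
    prod_(i in A) (d/dx_i) ^ d maps the multiples of u_A ^ (|A| d) onto all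
    forms ([mderivm_onto]): each derivation lowers the exponent of u_A by one,
    and what is left over can be integrated away.  Hence a form agrees, modulo
    u_A ^ (|A| d), with a form killed by this operator, that is, with a form
    none of whose monomials is divisible by (prod_(i in A) x_i) ^ d
    ([sum_vars_reduce_const]).  Applied to the three variables, then to the two
    variables whose exponent is not yet bounded, this shows that the standard
    monomials span R/J ([standard_span]).  There are none of degree at least
    a + b + c - 2.  This degree is below the characteristic, so R/J vanishes
    in it, hence in all higher degrees.

    Lower bound ([standard_count_leq_gdim]).  By Macaulay duality (R/J)_j is
    dual to the space of plane curves of degree j with prescribed
    multiplicities at the seven points with coordinates in {0, 1}.  Six lines
    pass through three of these points: the coordinate lines x_i = 0 and the
    diagonal lines x_i = x_j.  Counting conditions bounds the dimension from
    below ([gdim_geq_count]); multiplying a curve by x_0 x_1 x_2, or by the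
    product of the x_i - x_j, embeds the space for (a-1, b-1, c-1), or for
    (a-2, b-1, c), in degree j - 3 into the space for (a, b, c) in degree j.
    On the side of R/J these two multiplications are the surjections induced by
    the operators d_0 d_1 d_2 and (d_0 - d_1) (d_0 - d_2) (d_1 - d_2)
    ([gdim_geq_coordinate_lines], [gdim_geq_diagonal_lines]).  Once a line is
    forced into the base locus, the numbers of standard monomials on both sides
    of the corresponding step agree, and as long as no line is forced, the count
    of conditions is the number of standard monomials; so induction on j
    concludes.  Almost linearity enters here: a + 2c and 2b + c differ by at
    most one, which makes the diagonal step exact as soon as the count of
    conditions is not, and the step to (a-2, b-1, c) lowers the k of almost
    linearity by one. *)

(** * Dimension of a graded piece by spanning sequences *)

Definition monomials n d : seq 'X_{1..n} :=
  [seq s2m t | t : d.-tuple 'I_n <- enum (basis n d)].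

Lemma mem_monomials n d m : (m \in monomials n d) = (mdeg m == d).
Proof. by rewrite basis_cover. Qed.

Section Span.
Variables (n : nat) (K : fieldType).
Local Notation R := {mpoly K[n]}.

Definition in_span (I : R -> Prop) (gs : seq R) (p : R) : Prop :=
  exists c : nat -> K, I (p - \sum_(i < size gs) c i *: gs`_i).

Section Ideal.
Variable I : R -> Prop.
Hypothesis idI : ideal_axioms I.

Lemma ideal_sum (T : Type) (r : seq T) (P : pred T) (F : T -> R) :
  (forall i, P i -> I (F i)) -> I (\sum_(i <- r | P i) F i).
Proof. by move=> IF; apply: big_ind => //; case: idI. Qed.

Lemma idealZ (a : K) p : I p -> I (a *: p).
Proof. by move=> Ip; rewrite -mul_mpolyC; case: idI => _ _; apply. Qed.

Lemma in_span_mod gs p : I p -> in_span I gs p.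
Proof.
by move=> Ip; exists (fun=> 0); rewrite big1 ?subr0 // => i _; rewrite scale0r.
Qed.

Lemma in_span_mem gs p : p \in gs -> in_span I gs p.
Proof.
move=> pgs; exists (fun i => (i == index p gs)%:R).
have lt: (index p gs < size gs)%N by rewrite index_mem.
rewrite (bigD1 (Ordinal lt)) //= eqxx scale1r nth_index // big1; last first.
  by move=> i /negbTE; rewrite -val_eqE /= => ->; rewrite scale0r.
by rewrite addr0 subrr; case: idI.
Qed.

Lemma in_spanD gs p q : in_span I gs p -> in_span I gs q -> in_span I gs (p + q).
Proof.
move=> [c Ip] [e Iq]; exists (fun i => c i + e i).
under eq_bigr => i _ do rewrite scalerDl.
by rewrite big_split opprD addrACA; case: idI => _ + _; apply.
Qed.

Lemma in_spanZ gs a p : in_span I gs p -> in_span I gs (a *: p).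
Proof.
move=> [c Ip]; exists (fun i => a * c i).
under eq_bigr => i _ do rewrite -scalerA.
by rewrite -scaler_sumr -scalerBr; exact: idealZ.
Qed.

Lemma in_span_sum gs (T : eqType) (r : seq T) (F : T -> R) :
  (forall i, i \in r -> in_span I gs (F i)) -> in_span I gs (\sum_(i <- r) F i).
Proof.
move=> IF; rewrite big_seq; apply: big_ind IF; last exact: in_spanD.
by apply: in_span_mod; case: idI.
Qed.

(** Exchange inequality: the matrix expressing an independent family in a
    spanning one has independent rows. *)
Lemma free_leq_span d (b : 'I_d -> R) (gs : seq R) :
    (forall c : 'I_d -> K, I (\sum_(i < d) c i *: b i) -> forall i, c i = 0) ->
    (forall i, in_span I gs (b i)) ->
  (d <= size gs)%N.
Proof.
move=> fr /fin_all_exists[A AP]; pose M := \matrix_(i < d, k < size gs) A i k.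
suff /eqP<-: row_free M by exact: rank_leq_col.
apply/inj_row_free => v vM0; apply/rowP=> i; rewrite mxE.
apply: (fr (fun i => v 0 i)).
have ->: \sum_(i < d) v 0 i *: b i =
    \sum_(i < d) v 0 i *: (b i - \sum_(k < size gs) A i k *: gs`_k).
  under [RHS]eq_bigr do rewrite scalerBr.
  rewrite sumrB [X in _ - X](_ : _ = 0) ?subr0 //.
  under eq_bigr do rewrite scaler_sumr; rewrite exchange_big big1 //= => k _.
  under eq_bigr do rewrite scalerA; rewrite -scaler_suml.
  have := congr1 (fun u : 'rV_(size gs) => u 0 k) vM0.
  rewrite !mxE => vM0k.
  rewrite (_ : \sum_(i < d) _ = 0) ?scale0r // -[RHS]vM0k.
  by apply: eq_bigr => l _; rewrite mxE.
by apply: ideal_sum => k _; apply: idealZ.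
Qed.

Lemma gdim_leq_span j gs :
  (forall p, p \is j.-homog -> in_span I gs p) ->
  (graded_quotient_dim I j <= size gs)%N.
Proof.
move=> sp; have [b [hb _ fb]] := graded_quotient_dimP idI j.
exact: free_leq_span fb (fun i => sp _ (hb i)).
Qed.

Lemma gdim_span j :
  exists gs, [/\ size gs = graded_quotient_dim I j,
    {in gs, forall g, g \is j.-homog}
    & forall p, p \is j.-homog -> in_span I gs p].
Proof.
have [b [hb sb _]] := graded_quotient_dimP idI j.
exists (codom b); split=> [|g /codomP[i ->] //|p /sb[c Ic]].
  by rewrite size_codom card_ord.
suff ->: p = (p - \sum_i c i *: b i) + \sum_i c i *: b i.
  apply: in_spanD; first exact: in_span_mod.
  apply: in_span_sum => i _; apply/in_spanZ/in_span_mem; exact: codom_f.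
by rewrite subrK.
Qed.

End Ideal.

(** The image of a spanning sequence spans, so a surjection between graded
    pieces which maps one ideal into the other bounds dimensions from below. *)
Lemma leq_gdim_image (I I' : R -> Prop) (f : {linear R -> R}) j j' :
    ideal_axioms I -> ideal_axioms I' ->
    (forall p, I p -> I' (f p)) ->
    (forall p, p \is j'.-homog -> exists2 q, q \is j.-homog & f q = p) ->
  (graded_quotient_dim I' j' <= graded_quotient_dim I j)%N.
Proof.
move=> idI idI' fI fs; have [gs [<- _ gsP]] := gdim_span idI j.
rewrite -(size_map f); apply: gdim_leq_span => // p /fs[q /gsP[c Ic] <-].
exists c; rewrite size_map; have := fI _ Ic; rewrite linearB linear_sum.
congr (I' (_ - _)); apply: eq_bigr => i _.
by rewrite linearZ (nth_map 0).
Qed.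

Definition has_degrees (gs : seq R) (ds : seq nat) : Prop :=
  size ds = size gs /\
  forall i, (i < size gs)%N -> gs`_i \is (nth 0%N ds i).-homog.

Definition shifted_basis (j d : nat) : seq 'X_{1..n} :=
  if (d <= j)%N then monomials n (j - d) else [::].

(** The crude count of conditions: a basis of the quotient, together with all
    monomial multiples of the generators, spans the forms of degree [j]. *)
Lemma size_monomials_leq_gdim gs ds j : has_degrees gs ds ->
  (size (monomials n j) <= graded_quotient_dim (in_ideal_gen gs) j +
     \sum_(d <- ds) size (shifted_basis j d))%N.
Proof.
move=> [sds hgs].
have [bs [<- hbs bsP]] := gdim_span (in_ideal_gen_ideal gs) j.
pose zs := flatten [seq [seq 'X_[m] * gs`_i | m <- shifted_basis j (nth 0%N ds i)]
   | i <- iota 0 (size gs)].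
have szs: size zs = (\sum_(d <- ds) size (shifted_basis j d))%N.
  rewrite size_flatten /shape -map_comp sumnE big_map [RHS](big_nth 0%N) sds.
  by rewrite /index_iota subn0; apply: eq_bigr => i _; rewrite /= size_map.
rewrite -szs -size_cat.
have id0 : ideal_axioms (fun p : R => p = 0).
  by split=> // [p q -> ->|r p ->]; rewrite ?addr0 ?mulr0.
pose b (i : 'I_(size (monomials n j))) : R := 'X_[nth 0%MM (monomials n j) i].
apply: (free_leq_span (b := b) id0).
  move=> c /(congr1 (mcoeff (nth 0%MM (monomials n j) _))) c0 i.
  have := c0 i; rewrite linear_sum mcoeff0 (bigD1 i) //= mcoeffZ mcoeffX eqxx mulr1.
  rewrite big1 ?addr0 // => k /negbTE nk.
  by rewrite mcoeffZ mcoeffX nth_uniq ?uniq_basis // val_eqE nk mulr0.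
move=> i; have hb: b i \is j.-homog.
  by rewrite dhomogX -mem_monomials mem_nth.
have [c [e ce]] := bsP _ hb.
pose pj : {linear R -> R} := pihomog mdeg j.
have {ce}->: b i = \sum_(k < size bs) c k *: bs`_k
    + \sum_(k < size gs) pj (e k * gs`_k).
  (* Only the components of degree j of the coefficients e k matter. *)
  rewrite -(linear_sum pj) -ce linearB /= pihomog_dE // [X in _ - X]pihomog_dE.
    by rewrite addrC subrK.
  by apply: rpred_sum => k _; apply/rpredZ/hbs/mem_nth.
apply: (in_spanD id0).
  apply: (in_span_sum id0) => k _; apply/(in_spanZ id0)/(in_span_mem id0).
  by rewrite mem_cat mem_nth.
apply: (in_span_sum id0) => k _; rewrite [e k]mpolyE mulr_suml linear_sum /=.
apply: (in_span_sum id0) => m _; rewrite -scalerAl linearZ /=.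
apply: (in_spanZ id0); set d := nth 0%N ds k.
have hm: 'X_[m] * gs`_k \is (mdeg m + d).-homog.
  by rewrite dhomogM ?hgs // dhomogX.
have [jE|nj] := eqVneq (mdeg m + d)%N j; last first.
  by rewrite (pihomog_ne0 nj hm); apply: in_span_mod.
rewrite pihomog_dE -?jE //; apply: (in_span_mem id0).
rewrite mem_cat; apply/orP; right; apply/flatten_mapP; exists (val k).
  by rewrite mem_iota ltn_ord.
apply/mapP; exists m => //.
by rewrite /shifted_basis -/d -jE leq_addl addnK mem_monomials.
Qed.
End Span.

(** * Powers of a linear form and derivations *)

Definition char_above (K : nzRingType) (j : nat) : Prop :=
  forall i : nat, (0 < i <= j)%N -> i%:R != 0 :> K.

Lemma char_aboveW (K : nzRingType) j k :
  (j <= k)%N -> char_above K k -> char_above K j.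
Proof.
by move=> le_jk ch i /andP[i0 le_ij]; apply: ch; rewrite i0 (leq_trans le_ij).
Qed.

Lemma ffact_neq0 (K : idomainType) j x y : char_above K j ->
  (x <= j)%N -> (y <= x)%N -> (x ^_ y)%:R != 0 :> K.
Proof.
move=> ch le_xj; elim: y => [|y IH] lt_yx; first by rewrite ffactn0 oner_eq0.
rewrite ffactnSr natrM mulf_neq0 ?IH ?(ltnW lt_yx) //.
by apply: ch; rewrite subn_gt0 lt_yx /= (leq_trans (leq_subr _ _)).
Qed.

Section Derivations.
Variables (n : nat) (K : fieldType).
Local Notation R := {mpoly K[n]}.

Definition leibniz (d : R -> R) : Prop :=
  forall p q, d (p * q) = d p * q + p * d q.

(** [V k] stands for a space of forms of degree [k].  Besides all forms, these
    may be the forms of degree [k] in some of the variables only, with the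
    exponents of the other variables prescribed. *)
Definition derivation_graded (V : nat -> R -> Prop) (u : R) (d : R -> R) : Prop :=
  [/\ forall k a p q, V k p -> V k q -> V k (a *: p + q),
      forall k p, V k p -> V k.+1 (u * p),
      forall k p, V k.+1 p -> V k (d p)
    & forall p, V 0%N p -> d p = 0].

Lemma leibnizX d u M : leibniz d -> d (u ^+ M.+1) = u ^+ M * d u *+ M.+1.
Proof.
move=> Ld; elim: M => [|M IH]; first by rewrite expr1 mul1r.
rewrite exprS Ld IH mulrnAr mulrA -exprS [RHS]mulrSr addrC.
by congr (_ + _); rewrite mulrC.
Qed.

(** By Leibniz, [d (u ^+ M.+1 * g)] is a multiple of [u ^+ M * g] up to the
    error term [u ^+ M.+1 * d g]; as [d g] has smaller degree, this error is
    corrected by induction on the degree. *)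
Lemma leibniz_onto (V : nat -> R -> Prop) u (d : {linear R -> R}) k M g :
    leibniz d -> derivation_graded V u d -> d u = 1 ->
    char_above K (M.+1 + k) -> V k g ->
  exists2 q, V k q & d (u ^+ M.+1 * q) = u ^+ M * g.
Proof.
move=> Ld [Vlin Vu Vd V0] du1; elim: k M g => [|k IH] M g ch Vg.
  have M0: M.+1%:R != 0 :> K by apply: ch; rewrite addn0 leqnn.
  exists (M.+1%:R^-1 *: g).
    have Vz : V 0%N 0 by have := Vlin 0%N (-1) g g Vg Vg; rewrite scaleN1r addNr.
    by have := Vlin 0%N M.+1%:R^-1 g 0 Vg Vz; rewrite addr0.
  rewrite -scalerAr linearZ /= Ld leibnizX // (V0 g Vg) du1 mulr1 mulr0 addr0.
  by rewrite mulrnAl -scaler_nat scalerA mulVf // scale1r.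
have M0: M.+1%:R != 0 :> K by apply: ch; rewrite leq_addr.
have [|q' Vq' dq'] := IH M.+1 (d g) _ (Vd _ _ Vg).
  by apply: char_aboveW ch; rewrite addnS.
exists (M.+1%:R^-1 *: (g - u * q')).
  have Vg' : V k.+1 (g - u * q').
    by have := Vlin _ (-1) _ _ (Vu _ _ Vq') Vg; rewrite scaleN1r addrC.
  have Vz : V k.+1 0 by have := Vlin _ (-1) _ _ Vg Vg; rewrite scaleN1r addNr.
  by have := Vlin _ M.+1%:R^-1 _ _ Vg' Vz; rewrite addr0.
rewrite -scalerAr linearZ /= mulrBr linearB /= mulrA -exprSr dq' Ld leibnizX //.
rewrite du1 mulr1 addrK mulrnAl -scaler_nat scalerA mulVf //.
by rewrite scale1r.
Qed.

Lemma leibniz_mderiv i : leibniz (mderiv i).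
Proof. by move=> p q; rewrite mderivM. Qed.

Section Partial.
Variables (A : {set 'I_n}) (e : 'I_n -> nat).

Definition partial_homog (k : nat) (p : R) : Prop :=
  {in msupp p, forall m : 'X_{1..n},
    (forall i, i \notin A -> m i = e i) /\ (\sum_(i in A) m i)%N = k}.

Definition sum_vars : R := \sum_(i in A) 'X_i.

Lemma mderiv_sum_vars i : mderiv i sum_vars = (i \in A)%:R.
Proof.
rewrite /sum_vars linear_sum /=.
have E j : ('X_j : R)^`M(i) = (i == j)%:R.
  rewrite mderivX mnm1E eq_sym; case: eqP => [->|_]; last by rewrite scale0r.
  rewrite scale1r; have ->: (U_(j) - U_(j) = 0 :> 'X_{1..n})%MM.
    by apply/mnmP=> k; rewrite mnmBE subnn mnm0E.
  by rewrite mpolyX0.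
under eq_bigr do rewrite E; have [iA|iA] := boolP (i \in A).
  rewrite (bigD1 i) //= eqxx big1 ?addr0 // => j /andP[_ /negbTE].
  by rewrite eq_sym => ->.
by rewrite big1 // => j jA; case: eqP iA => // ->; rewrite jA.
Qed.

Lemma sum_mnmD1 (m : 'X_{1..n}) i :
  (\sum_(l in A) (m + U_(i))%MM l = \sum_(l in A) m l + (i \in A))%N.
Proof.
under eq_bigr do rewrite mnmDE mnm1E; rewrite big_split /=; congr (_ + _)%N.
have [iA|iA] := boolP (i \in A).
  rewrite (bigD1 i) //= eqxx big1 // => l /andP[_ /negbTE].
  by rewrite eq_sym => ->.
by rewrite big1 // => l lA; case: eqP iA => // ->; rewrite lA.
Qed.

Lemma partial_homogP k p : partial_homog k p <->
  forall m, p@_m != 0 ->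
    (forall i, i \notin A -> m i = e i) /\ (\sum_(i in A) m i)%N = k.
Proof.
by split=> H m; [rewrite -mcoeff_msupp | rewrite mcoeff_msupp]; apply: H.
Qed.

Lemma partial_homog_lin k a p q :
  partial_homog k p -> partial_homog k q -> partial_homog k (a *: p + q).
Proof.
move=> /partial_homogP hp /partial_homogP hq; apply/partial_homogP => m.
rewrite mcoeffD mcoeffZ; have [p0|/hp//] := eqVneq p@_m 0.
by rewrite p0 mulr0 add0r => /hq.
Qed.

Lemma partial_homog_sum_vars k p :
  partial_homog k p -> partial_homog k.+1 (sum_vars * p).
Proof.
move=> hp m; rewrite mulr_suml => /msupp_sum_le /flatten_mapP[i].
rewrite mem_filter => /andP[iA _]; rewrite mulrC (perm_mem (msuppMX _ _)).
move=> /mapP[m' /hp[oA sA] ->]; split=> [l lA|].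
  rewrite mnmDE mnm1E oA //; case: eqP => // il; by rewrite -il iA in lA.
by rewrite addmC sum_mnmD1 sA iA addn1.
Qed.

Lemma partial_homog_mderiv i k p : i \in A ->
  partial_homog k.+1 p -> partial_homog k (mderiv i p).
Proof.
move=> iA /partial_homogP hp; apply/partial_homogP=> m.
rewrite mcoeff_deriv => nz; have /hp[oA sA]: p@_(m + U_(i)) != 0.
  by apply: contraNneq nz => ->; rewrite mul0rn.
split=> [l lA|].
  have := oA l lA; rewrite mnmDE mnm1E; case: eqP => [il|_]; last by rewrite addn0.
  by rewrite -il iA in lA.
by move: sA; rewrite sum_mnmD1 iA addn1 => -[].
Qed.

Lemma mderiv_partial_homog0 i p : i \in A -> partial_homog 0 p -> mderiv i p = 0.
Proof.
move=> iA /partial_homogP hp; apply/mpolyP=> m; rewrite mcoeff_deriv mcoeff0.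
have [-> | /hp[_ ]] := eqVneq p@_(m + U_(i)) 0; first by rewrite mul0rn.
by rewrite (bigD1 i) //= mnmDE mnm1E eqxx addn1.
Qed.

Lemma derivation_graded_partial i : i \in A ->
  derivation_graded partial_homog sum_vars (mderiv i).
Proof.
move=> iA; split; [exact: partial_homog_lin | exact: partial_homog_sum_vars| |].
- by move=> k p; apply: partial_homog_mderiv.
- by move=> p; apply: mderiv_partial_homog0.
Qed.

(** One application of [leibniz_onto] for each derivative in [mm]. *)
Lemma mderivm_onto (mm : 'X_{1..n}) k g :
    (forall i, i \notin A -> mm i = 0%N) ->
    char_above K (mdeg mm + k) -> partial_homog k g ->
  exists2 q, partial_homog k q & (sum_vars ^+ mdeg mm * q)^`M[mm] = g.
Proof.
move sE: (mdeg mm) => s; elim: s mm sE => [|s IH] mm sE mmA ch hg.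
  exists g => //; move/eqP: sE; rewrite mdeg_eq0 => /eqP->.
  by rewrite mul1r mderivm0m.
have [i mi]: exists i, mm i != 0%N.
  apply/existsP; apply: contra_eqT sE; rewrite negb_exists => /forallP mm0.
  rewrite mdegE big1 // => i _; apply/eqP; by have := mm0 i; rewrite negbK.
have iA: i \in A by apply: contraR mi => /mmA ->.
have mE: mm = (U_(i) + (mm - U_(i)))%MM by rewrite addmC submK // lep1mP.
have sE': mdeg (mm - U_(i))%MM = s.
  by have := congr1 (@mdeg n) mE; rewrite sE mdegD mdeg1 add1n => -[].
have mmA' l : l \notin A -> (mm - U_(i))%MM l = 0%N.
  by move=> /mmA; rewrite mnmBE => ->.
have ch' : char_above K (s + k) by apply: char_aboveW ch; rewrite addSn.
have [q' hq' dq'] := IH _ sE' mmA' ch' hg.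
have du1 : mderiv i sum_vars = 1 by rewrite mderiv_sum_vars iA.
have [] := leibniz_onto (leibniz_mderiv i) (derivation_graded_partial iA) du1 ch hq'.
by move=> q hq dq; exists q; rewrite // mE mderivmDm mderivmU1m dq.
Qed.

Lemma partial_homog_sum_varsX s k q :
  partial_homog k q -> partial_homog (s + k) (sum_vars ^+ s * q).
Proof.
move=> hq; elim: s => [|s IH]; first by rewrite mul1r.
by rewrite exprS -mulrA addSn; apply: partial_homog_sum_vars.
Qed.

(** Choose [q] so that the multiple of [sum_vars] and [p] have the same
    derivative [mm]; the difference is then killed by that derivative, which in
    small degree multiplies each coefficient by a nonzero scalar or discards it. *)
Lemma sum_vars_reduce (mm : 'X_{1..n}) k p :
    (forall i, i \notin A -> mm i = 0%N) ->
    char_above K k -> partial_homog k p ->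
  exists q, partial_homog k (p - sum_vars ^+ mdeg mm * q) /\
    {in msupp (p - sum_vars ^+ mdeg mm * q), forall m, ~~ (mm <= m)%MM}.
Proof.
move=> mmA ch hp.
have mmE: mdeg mm = (\sum_(i in A) mm i)%N.
  rewrite mdegE (bigID (fun i => i \in A)) /= [X in (_ + X)%N]big1 ?addn0 //.
have [lt_ks | le_sk] := ltnP k (mdeg mm).
  exists 0; rewrite mulr0 subr0; split=> // m /hp[_ sA].
  apply: contraL lt_ks => /mnm_lepP le; rewrite -leqNgt -sA mmE.
  exact: leq_sum.
have kE: (mdeg mm + (k - mdeg mm) = k)%N by rewrite subnKC.
have hg: partial_homog (k - mdeg mm) (p^`M[mm]).
  apply/partial_homogP=> m; rewrite mcoeff_mderivm => nz.
  have: p@_(mm + m)%MM != 0 by apply: contraNneq nz => ->; rewrite mul0rn.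
  move/(proj1 (partial_homogP k p) hp) => -[oA sA]; split=> [i iA|].
    by rewrite -oA // mnmDE mmA.
  by rewrite -sA mmE -sumnB => [|i _]; rewrite ?mnmDE ?leq_addr //;
     apply: eq_bigr => i _; rewrite mnmDE addKn.
have [|q hq dq] := mderivm_onto mmA _ hg; first by rewrite kE.
exists q; have hr: partial_homog k (p - sum_vars ^+ mdeg mm * q).
  have hq' : partial_homog k (sum_vars ^+ mdeg mm * q).
    by rewrite -[X in partial_homog X]kE; apply: partial_homog_sum_varsX.
  by have := partial_homog_lin (a := -1) hq' hp; rewrite scaleN1r addrC.
split=> // m mr; apply/negP=> le_mm.
have mE: (mm + (m - mm) = m)%MM.
  by apply/mnmP=> i; rewrite mnmDE mnmBE subnKC //; apply/mnm_lepP.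
have := congr1 (mcoeff (m - mm)) (mderivmB mm p (sum_vars ^+ mdeg mm * q)).
rewrite dq subrr mcoeff0 mcoeff_mderivm mE; apply/eqP.
rewrite -mulr_natr mulf_neq0 -?mcoeff_msupp // natr_prod.
apply/prodf_neq0 => i _; have [iA|iA] := boolP (i \in A); last first.
  by rewrite mmA // ffactn0 oner_eq0.
apply: (ffact_neq0 ch); last exact/mnm_lepP.
have [_ <-] := hr _ mr; by rewrite (bigD1 i) //= leq_addr.
Qed.

Lemma sum_vars_reduce_const d k p : char_above K k -> partial_homog k p ->
  exists q, partial_homog k (p - sum_vars ^+ (#|A| * d) * q) /\
    {in msupp (p - sum_vars ^+ (#|A| * d) * q), forall m : 'X_{1..n},
       exists2 i, i \in A & (m i < d)%N}.
Proof.
move=> ch hp; pose mm := [multinom (if i \in A then d else 0)%N | i < n].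
have mmE: mdeg mm = (#|A| * d)%N.
  rewrite mdegE -sum_nat_const [RHS]big_mkcond /=.
  by apply: eq_bigr => i _; rewrite mnmE.
have [|q [hq rq]] := sum_vars_reduce (mm := mm) _ ch hp.
  by move=> i /negbTE iA; rewrite mnmE iA.
rewrite mmE in hq rq; exists q; split=> // m /rq.
rewrite negb_forall => /existsP[i]; rewrite -ltnNge mnmE.
by case: ifP => // iA lt; exists i.
Qed.

End Partial.
End Derivations.

(** * The standard monomials span *)

Lemma ord3P (i : 'I_3) : [\/ i = 0, i = 1 | i = 2].
Proof.
case: i => [[|[|[|//]]] lt]; [apply: Or31 | apply: Or32 | apply: Or33];
  exact: val_inj.
Qed.

Lemma big_ord3 (T : Type) (idx : T) (op : Monoid.law idx) (F : 'I_3 -> T) :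
  \big[op/idx]_i F i = op (F 0) (op (F 1) (F 2)).
Proof.
rewrite 3!big_ord_recl big_ord0 Monoid.mulm1.
by congr (op _ (op (F _) (F _))); apply: val_inj.
Qed.

Lemma mdeg3 (m : 'X_{1..3}) : mdeg m = (m 0%R + (m 1%R + m 2%R))%N.
Proof. by rewrite mdegE big_ord3. Qed.

Section Ideal.
Variable K : fieldType.
Local Notation R := {mpoly K[3]}.

(** The generators depend on three exponents instead of a function, since the
    induction for the lower bound changes the exponents. *)
Definition power_gens (a b c : nat) : seq R :=
  J_gens K (fun i => nth 0%N [:: a; b; c] i).
Local Notation J a b c := (in_ideal_gen (power_gens a b c)).

Lemma in_ideal_gen_mem (gs : seq R) g : g \in gs -> in_ideal_gen gs g.
Proof.
move=> ggs; have lt: (index g gs < size gs)%N by rewrite index_mem.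
exists (fun i => (i == Ordinal lt)%:R).
rewrite (bigD1 (Ordinal lt)) //= eqxx mul1r nth_index // big1 ?addr0 //.
by move=> i /negbTE->; rewrite mul0r.
Qed.

Lemma in_ideal_genMr (gs : seq R) g q : g \in gs -> in_ideal_gen gs (g * q).
Proof. by move=> ggs; rewrite mulrC; apply/in_ideal_genM/in_ideal_gen_mem. Qed.

(** Exponents of the monomials outside the ideal generated by the [a]-th powers
    of the variables, the [b]-th powers of their products by two and the [c]-th
    power of their product. *)
Definition standard (a b c : nat) (x y z : nat) : bool :=
  ~~ [|| (a <= x)%N, (a <= y)%N, (a <= z)%N,
      (b <= x)%N && (b <= y)%N, (b <= x)%N && (b <= z)%N, (b <= y)%N && (b <= z)%N
    | [&& (c <= x)%N, (c <= y)%N & (c <= z)%N]].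

Definition standard_monomials (a b c j : nat) : seq 'X_{1..3} :=
  [seq m : 'X_{1..3} <- monomials 3 j | standard a b c (m 0%R) (m 1%R) (m 2%R)].

Variables a b c : nat.

Lemma power_gensE : power_gens a b c =
  [seq sum_vars K [set k] ^+ a | k <- [:: 0; 1; 2]] ++
  [seq sum_vars K (~: [set k]) ^+ (2 * b) | k <- [:: 2; 1; 0]] ++
  [:: sum_vars K setT ^+ (3 * c)].
Proof.
have sumE (A : {set 'I_3}) : sum_vars K A = (if 0 \in A then 'X_0 else 0)
    + ((if 1 \in A then 'X_1 else 0) + (if 2 \in A then 'X_2 else 0)).
  by rewrite /sum_vars big_mkcond big_ord3.
by rewrite /= !sumE !inE /= !add0r !addr0 addrA.
Qed.

Lemma power_gens1 i : 'X_i ^+ a \in power_gens a b c.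
Proof. by rewrite !inE; case: (ord3P i) => ->; rewrite eqxx ?orbT. Qed.

Lemma power_gens2 k : sum_vars K (~: [set k]) ^+ (2 * b) \in power_gens a b c.
Proof. by rewrite power_gensE !inE; case: (ord3P k) => ->; rewrite eqxx ?orbT. Qed.

Lemma power_gens3 : sum_vars K setT ^+ (3 * c) \in power_gens a b c.
Proof. by rewrite power_gensE !inE eqxx !orbT. Qed.

Hypotheses (leab : (b <= a)%N) (lebc : (c <= b)%N).

(** Reducing by the power of [x_0 + x_1 + x_2] leaves monomials with an exponent
    [m k < c].  The reduction in the two other variables fixes [m k] and leaves
    a second exponent below [b]; the remaining exponent is below [a] or the
    monomial is in the ideal. *)
Lemma standard_span j (p : R) : char_above K j -> p \is j.-homog ->
  in_span (J a b c) [seq 'X_[m] | m <- standard_monomials a b c j] p.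
Proof.
move=> ch hp; have idJ := in_ideal_gen_ideal (power_gens a b c).
set gs := map _ _.
have S1 m k l : mdeg m = j -> (m k < c)%N -> l != k -> (m l < b)%N ->
    in_span (J a b c) gs 'X_[m].
  move=> dm mk nlk ml.
  have [i ai|lta] := pickP (fun i => a <= m i)%N.
    apply: in_span_mod.
    rewrite (_ : m = (U_(i) *+ a + (m - U_(i) *+ a))%MM).
      by rewrite mpolyXD -mpolyXn; apply/in_ideal_genMr/power_gens1.
    apply/mnmP=> t; rewrite mnmDE mnmBE mulmnE mnm1E.
    by case: eqP => [<-|_]; rewrite ?mul1n ?mul0n ?subn0 // subnKC.
  apply/(in_span_mem idJ)/map_f; rewrite mem_filter mem_monomials dm eqxx andbT.
  move: (lta 0) (lta 1) (lta 2) nlk mk ml leab lebc; rewrite /standard.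
  case: (ord3P k) => ->; case: (ord3P l) => -> /=; rewrite ?eqxx //;
    by clear; move: (m 0) (m 1) (m 2) => x y z; lia.
have S2 m k : mdeg m = j -> (m k < c)%N -> in_span (J a b c) gs 'X_[m].
  move=> dm mk; pose A := ~: [set k].
  have Ak i : (i \notin A) = (i == k) by rewrite !inE negbK.
  have sA (m' : 'X_{1..3}) : mdeg m' = (m' k + \sum_(i in A) m' i)%N.
    rewrite mdegE (bigD1 k) //=; congr (_ + _)%N; apply: eq_bigl => i.
    by rewrite !inE.
  have hX: partial_homog A m (\sum_(i in A) m i) ('X_[m] : R).
    by move=> m' /mem_msuppXP<-.
  have chA: char_above K (\sum_(i in A) m i).
    by apply: char_aboveW ch; rewrite -dm sA leq_addl.
  have [q [hr rr]] := sum_vars_reduce_const b chA hX.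
  have cA: #|A| = 2 by rewrite cardsC1 card_ord.
  rewrite cA in hr rr; set r := 'X_[m] - _ in hr rr.
  rewrite (_ : 'X_[m] = sum_vars K A ^+ (2 * b) * q + r); last by rewrite addrC subrK.
  apply: (in_spanD idJ); first by apply/in_span_mod/in_ideal_genMr/power_gens2.
  rewrite [r]mpolyE; apply: (in_span_sum idJ) => m' m'r; apply: (in_spanZ idJ).
  have [oA sA'] := hr _ m'r; have [l lA ml] := rr _ m'r.
  have m'k : m' k = m k by apply: oA; rewrite Ak.
  apply: (S1 m' k l); rewrite ?m'k //; first by rewrite sA m'k sA' -sA.
  by rewrite -Ak lA.
have hp' : partial_homog [set: 'I_3] (fun=> 0%N) j p.
  move=> m /(dhomog_mf hp); rewrite -[X in X = _]/(mdeg m) => dm.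
  split=> [i|]; first by rewrite inE.
  by rewrite -dm mdegE; apply: eq_bigl => i; rewrite inE.
have [q [hr rr]] := sum_vars_reduce_const c ch hp'.
have cA: #|[set: 'I_3]| = 3 by rewrite cardsT card_ord.
rewrite cA in hr rr; set r := p - _ in hr rr.
rewrite (_ : p = sum_vars K [set: 'I_3] ^+ (3 * c) * q + r); last first.
  by rewrite addrC subrK.
apply: (in_spanD idJ); first by apply/in_span_mod/in_ideal_genMr/power_gens3.
rewrite [r]mpolyE; apply: (in_span_sum idJ) => m mr; apply: (in_spanZ idJ).
have [_ sA] := hr _ mr; have [k _ mk] := rr _ mr; apply: (S2 m k) => //.
by rewrite -sA mdegE; apply: eq_bigl => i; rewrite inE.
Qed.

Lemma standard_monomials_nil j :
  (0 < c)%N -> (a + b + c - 2 <= j)%N -> standard_monomials a b c j = [::].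
Proof.
move=> c0 le_j; apply/eqP; rewrite -[_ == _]negbK -has_filter.
by apply/hasPn => m; rewrite mem_monomials mdeg3 /standard; lia.
Qed.

(** At degree [a + b + c - 2] the characteristic is still large enough for
    [standard_span], and there are no standard monomials; higher degrees follow
    by multiplication. *)
Lemma power_quotient_vanish j (p : R) : (0 < c)%N ->
  char_above K (a + b + c - 2) -> (a + b + c - 2 <= j)%N -> p \is j.-homog ->
  J a b c p.
Proof.
move=> c0 ch; have idJ := in_ideal_gen_ideal (power_gens a b c).
suff: forall i (m : 'X_{1..3}), mdeg m = (a + b + c - 2 + i)%N -> J a b c 'X_[m].
  move=> H le_j hp; rewrite [p]mpolyE big_seq; apply: (ideal_sum idJ) => m mp.
  by apply/(idealZ idJ)/(H (j - (a + b + c - 2))%N); rewrite subnKC // (dhomog_mf hp).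
elim=> [|i IH] m dm.
  have [|e] := standard_span ch (p := 'X_[m]); first
    by rewrite dhomogX; apply/eqP; rewrite -[LHS]/(mdeg m) dm addn0.
  by rewrite standard_monomials_nil // big_ord0 subr0.
have [l ml]: exists l, m l != 0%N.
  apply/existsP; apply: contra_eqT dm; rewrite negb_exists => /forallP mm0.
  rewrite mdegE big1 => [|l _]; first by rewrite addnS.
  by apply/eqP; have := mm0 l; rewrite negbK.
have mE: m = (U_(l) + (m - U_(l)))%MM by rewrite addmC submK // lep1mP.
rewrite mE mpolyXD; apply/in_ideal_genM/IH.
by have := congr1 (@mdeg 3) mE; rewrite dm mdegD mdeg1; lia.
Qed.

End Ideal.

(** * Counting standard monomials *)

Lemma mdegB_leq n (v m : 'X_{1..n}) :
  (v <= m)%MM -> (mdeg v + mdeg (m - v)%MM)%N = mdeg m.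
Proof. by move=> le_vm; rewrite -mdegD addmC submK. Qed.

Lemma count_monomials_geq n (v : 'X_{1..n}) j :
  count (fun m => (v <= m)%MM) (monomials n j) = size (shifted_basis n j (mdeg v)).
Proof.
rewrite /shifted_basis; case: leqP => [le_vj|lt_jv]; last first.
  apply/eqP; rewrite -leqn0 leqNgt -has_count; apply/hasPn => m.
  rewrite mem_monomials => /eqP dm; apply: contraL lt_jv => /mdegB_leq.
  by rewrite dm -leqNgt => <-; rewrite leq_addr.
rewrite -size_filter -[RHS](size_map (fun m => m + v)%MM); apply/perm_size/uniq_perm.
- by rewrite filter_uniq ?uniq_basis.
- by rewrite map_inj_uniq ?uniq_basis //; apply: addIm.
move=> m; rewrite mem_filter mem_monomials; apply/andP/mapP => [[vm /eqP dm]|].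
  exists (m - v)%MM; last by rewrite submK.
  by rewrite mem_monomials -dm -(mdegB_leq vm) addKn.
move=> [m' + ->]; rewrite mem_monomials => /eqP dm'.
by rewrite mdegD dm' subnK // eqxx lem_addl.
Qed.

(** The dimension of the forms of degree [j - d], zero when [j < d]. *)
Definition dim3 (d j : nat) : nat := size (shifted_basis 3 j d).

Lemma dim3E d j : dim3 d j = if (d <= j)%N then 'C(j - d + 2, 2) else 0%N.
Proof.
rewrite /dim3 /shifted_basis; case: leqP => // _.
by rewrite size_basis -bin_sub ?leq_addr // addKn.
Qed.

(** The polynomial formula still holds for [d = j + 1] and [d = j + 2], where
    both sides vanish; this slack is what the induction steps below need. *)
Lemma dim3_poly d j : (d <= j + 2)%N ->
  (2%:Z * (dim3 d j)%:Z = (j%:Z - d%:Z + 2) * (j%:Z - d%:Z + 1)).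
Proof.
move=> le_d; rewrite dim3E; case: leqP => [le_dj|lt_jd]; last first.
  have [->|->] : d = (j + 1)%N \/ d = (j + 2)%N by lia.
    by rewrite PoszD; ring.
  by rewrite PoszD; ring.
have [e ->] : exists e, j = (d + e)%N by exists (j - d)%N; rewrite subnKC.
have := mul_bin_diag e.+2 1; rewrite bin1 addKn addn2 => E.
have {E} : (2%:Z * 'C(e.+2, 2)%:Z = e.+2%:Z * e.+1%:Z).
  by rewrite -!PoszM -E.
move=> ->; rewrite -[e.+2]addn2 -[e.+1]addn1 !PoszD; ring.
Qed.

Lemma dim3_small d j : (j < d)%N -> dim3 d j = 0%N.
Proof. by move=> lt_jd; rewrite dim3E leqNgt lt_jd. Qed.

Lemma dim3_shift s d j : (s <= j)%N -> dim3 d (j - s) = dim3 (d + s) j.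
Proof. by move=> le_sj; rewrite !dim3E leq_subRL // addnC subnDA subnAC. Qed.

Definition numer_terms (a b c : nat) : seq (int * nat) :=
  [:: (1%R, 0%N); ((-3)%R, a); ((-3)%R, 2 * b); ((-1)%R, 3 * c); (3%R, 2 * b + c);
      (3%R, a + 2 * c); (6%R, a + b); ((-6)%R, a + b + c)]%N.

Definition standard_count (a b c j : nat) : int :=
  \sum_(t <- numer_terms a b c) t.1 * (dim3 t.2 j)%:Z.

Definition ge3 (v : nat * nat * nat) (x y z : nat) : bool :=
  [&& v.1.1 <= x, v.1.2 <= y & v.2 <= z]%N.

(** Inclusion-exclusion over the lcms of the generators of the monomial ideal,
    after cancellation. *)
Definition lcm_terms (a b c : nat) : seq (int * (nat * nat * nat)) :=
  [:: (1%R, (0, 0, 0)); ((-1)%R, (a, 0, 0)); ((-1)%R, (0, a, 0)); ((-1)%R, (0, 0, a));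
      ((-1)%R, (b, b, 0)); ((-1)%R, (b, 0, b)); ((-1)%R, (0, b, b)); ((-1)%R, (c, c, c));
      (1%R, (b, b, c)); (1%R, (b, c, b)); (1%R, (c, b, b));
      (1%R, (a, c, c)); (1%R, (c, a, c)); (1%R, (c, c, a));
      (1%R, (a, b, 0)); (1%R, (a, 0, b)); (1%R, (b, a, 0));
      (1%R, (0, a, b)); (1%R, (b, 0, a)); (1%R, (0, b, a));
      ((-1)%R, (a, b, c)); ((-1)%R, (a, c, b)); ((-1)%R, (b, a, c));
      ((-1)%R, (c, a, b)); ((-1)%R, (b, c, a)); ((-1)%R, (c, b, a))]%N.

Lemma standard_lcm_terms a b c x y z : (b <= a)%N -> (c <= b)%N ->
  (standard a b c x y z : nat)%:Z =
  \sum_(t <- lcm_terms a b c) t.1 * (ge3 t.2 x y z : nat)%:Z.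
Proof.
move=> leab lebc; rewrite /standard unlock /= /ge3 /=.
have chain w : (((a <= w) ==> (b <= w)) && ((b <= w) ==> (c <= w)))%N.
  by apply/andP; split; apply/implyP; apply: leq_trans.
move: (chain x) (chain y) (chain z).
case: (a <= x)%N; case: (b <= x)%N; case: (c <= x)%N => //= _;
case: (a <= y)%N; case: (b <= y)%N; case: (c <= y)%N => //= _;
by case: (a <= z)%N; case: (b <= z)%N; case: (c <= z)%N.
Qed.

Lemma size_standard_monomials a b c j : (b <= a)%N -> (c <= b)%N ->
  (size (standard_monomials a b c j))%:Z = standard_count a b c j.
Proof.
move=> leab lebc; rewrite size_filter -sum1_count big_mkcond.
transitivity (\sum_(m <- monomials 3 j) \sum_(t <- lcm_terms a b c)
    t.1 * (ge3 t.2 (m 0%R) (m 1%R) (m 2%R) : nat)%:Z).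
  rewrite (big_morph Posz PoszD (erefl _)); apply: eq_bigr => m _.
  by rewrite -standard_lcm_terms //; case: ifP.
rewrite exchange_big /=.
transitivity (\sum_(t <- lcm_terms a b c)
    t.1 * (dim3 (t.2.1.1 + (t.2.1.2 + t.2.2)) j)%:Z).
  apply: eq_bigr => -[s [[p q] r]] _ /=; rewrite -mulr_sumr; congr (_ * _).
  rewrite -(big_morph Posz PoszD (erefl _)); congr Posz.
  pose v : 'X_{1..3} := [multinom nth 0%N [:: p; q; r] i | i < 3].
  have dv : mdeg v = (p + (q + r))%N by rewrite mdeg3 !mnmE.
  rewrite -dv /dim3 -count_monomials_geq -sum1_count [RHS]big_mkcond.
  apply: eq_bigr => m _; rewrite /ge3 /=.
  suff ->: (v <= m)%MM = [&& p <= m 0%R, q <= m 1%R & r <= m 2%R]%N by case: ifP.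
  apply/mnm_lepP/and3P => [le|[le0 le1 le2] i].
    by have := le 0; have := le 1; have := le 2; rewrite !mnmE.
  by case: (ord3P i) => ->; rewrite mnmE.
rewrite /standard_count unlock /=.
do ![rewrite ?addn0 ?add0n].
(* Equal degrees are brought to the same form. *)
have -> : (b + (c + b) = b + (b + c))%N by lia.
have -> : (c + (b + b) = b + (b + c))%N by lia.
have -> : (c + (a + c) = a + (c + c))%N by lia.
have -> : (c + (c + a) = a + (c + c))%N by lia.
have -> : (b + a = a + b)%N by lia.
have -> : (a + (c + b) = a + (b + c))%N by lia.
have -> : (b + (a + c) = a + (b + c))%N by lia.
have -> : (c + (a + b) = a + (b + c))%N by lia.
have -> : (b + (c + a) = a + (b + c))%N by lia.
have -> : (b + (b + c) = 2 * b + c)%N by lia.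
have -> : (a + (c + c) = a + 2 * c)%N by lia.
have -> : (a + (b + c) = a + b + c)%N by lia.
have -> : (b + b = 2 * b)%N by lia.
have -> : (c + (c + c) = 3 * c)%N by lia.
by lia.
Qed.

Lemma standard_count0 a b j : standard_count a b 0 j = 0.
Proof.
rewrite /standard_count unlock /= !muln0 !addn0; ring.
Qed.

(** After the terms of equal degree have cancelled, the difference of the two
    sides is a sum of values of [dim3] in the range of [dim3_poly], where it is
    the zero polynomial. *)
Lemma standard_count_coordinate_lines a b c j :
    (b <= a)%N -> (c <= b)%N -> (0 < c)%N -> (a + b <= j.+1)%N -> (3 <= j)%N ->
  standard_count a b c j = standard_count a.-1 b.-1 c.-1 (j - 3).
Proof.
case: a b c => [|a] [|b] [|c] //= leab lebc _ lej le3.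
have P d := @dim3_poly d j.
rewrite /standard_count unlock /= !dim3_shift //.
rewrite (_ : 3 * c + 3 = 3 * c.+1)%N; last by lia.
rewrite (_ : 2 * b + c + 3 = 2 * b.+1 + c.+1)%N; last by lia.
rewrite (_ : a + 2 * c + 3 = a.+1 + 2 * c.+1)%N; last by lia.
rewrite (_ : a + b + c + 3 = a.+1 + b.+1 + c.+1)%N; last by lia.
have := P 0%N ltac:(lia); have := P (0 + 3)%N ltac:(lia).
have := P a.+1 ltac:(lia); have := P (a + 3)%N ltac:(lia).
have := P (2 * b.+1)%N ltac:(lia); have := P (2 * b + 3)%N ltac:(lia).
have := P (a.+1 + b.+1)%N ltac:(lia); have := P (a + b + 3)%N ltac:(lia).
lia.
Qed.

(** Same principle; the terms of degrees [a + b] and [a + b + c], which may be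
    out of range, occur identically on both sides. *)
Lemma standard_count_diagonal_lines a b c j :
    (c < b)%N -> (b < a)%N ->
    (a + 2 * c <= j.+1)%N -> (2 * b + c <= j.+1)%N -> (5 <= j)%N ->
  standard_count a b c j = standard_count (a - 2) b.-1 c (j - 3).
Proof.
move=> ltcb ltba le1 le2 le5; have P d := @dim3_poly d j.
have [a' aE] : exists a', a = a'.+2 by exists (a - 2)%N; lia.
have [b' bE] : exists b', b = b'.+1 by exists b.-1; lia.
subst a b; rewrite /standard_count unlock /= !dim3_shift ?(leq_trans _ le5) //.
rewrite subn2 /=.
rewrite (_ : a' + b' + 3 = a'.+2 + b'.+1)%N; last by lia.
rewrite (_ : a' + b' + c + 3 = a'.+2 + b'.+1 + c)%N; last by lia.
move: (dim3 (a'.+2 + b'.+1) j) (dim3 (a'.+2 + b'.+1 + c) j) => top1 top2.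
apply: (@mulfI _ (2%:Z)) => //.
rewrite !mulrDr !mulr0 !(mulrCA 2%:Z) !P; lia.
Qed.

(** * The Hilbert series as a power series quotient *)

Lemma coef_1subX3 (i : nat) :
  ((1 - 'X) ^+ 3 : {poly int})`_i =
  (i == 0%N)%:Z - 3 * (i == 1%N)%:Z + 3 * (i == 2%N)%:Z - (i == 3%N)%:Z.
Proof.
have ->: (1 - 'X) ^+ 3 = 1%:P - 3%:P * 'X + 3%:P * 'X^2 - 'X^3 :> {poly int}.
  by rewrite polyC1 !polyCMn polyC1; ring.
rewrite !coefB coefD coefB !coefCM !coefX !coefXn coefC.
by case: i => [|[|[|[|i]]]].
Qed.

(** [t ^ d / (1 - t) ^ 3] is the series of [dim3 d]. *)
Lemma dim3_1subX3 d j :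
  fps_mul (fun i => (dim3 d i)%:Z) (poly_fps ((1 - 'X) ^+ 3)) j = (j == d)%:Z.
Proof.
rewrite /fps_mul /poly_fps.
under eq_bigr do rewrite coef_1subX3 !(mulrBr, mulrDr) !(mulrCA _ 3).
have S k : \sum_(i < j.+1) (dim3 d i)%:Z * (j - i == k)%N%:Z
   = (if (k <= j)%N then dim3 d (j - k) else 0%N)%:Z.
  case: leqP => [le_kj|lt_jk].
    rewrite (bigD1 (inord (j - k))) //= inordK ?ltnS ?leq_subr // subKn // eqxx.
    rewrite mulr1 big1 ?addr0 // => i; rewrite -val_eqE /= inordK ?ltnS ?leq_subr //.
    move=> ne; rewrite (_ : (j - i == k)%N = false) ?mulr0 //.
    by have := ltn_ord i; lia.
  rewrite big1 // => i _; rewrite (_ : (j - i == k)%N = false) ?mulr0 //; lia.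
rewrite !(big_split, sumrN) /= -!mulr_sumr !S.
have [lt_jd|le_dj] := ltnP j d.
  have Z k : dim3 d (j - k) = 0%N.
    by rewrite dim3_small // (leq_ltn_trans (leq_subr _ _)).
  by rewrite !Z !if_same (ltn_eqF lt_jd).
have [e ->] : exists e, j = (d + e)%N by exists (j - d)%N; rewrite subnKC.
have E k : (if k <= d + e then dim3 d (d + e - k) else 0)%N
         = (if k <= e then 'C(e - k + 2, 2) else 0)%N.
  case: (leqP k e) => le_ke; last by case: leqP => // le_k; rewrite dim3_small; lia.
  rewrite (leq_trans le_ke) ?leq_addl // dim3E -addnBA // leq_addr.
  by rewrite addKn.
rewrite (E 0%N) !E -[X in _ == X]addn0 eqn_add2l.
case: e {le_dj E} => [|[|[|e]]] //=.
rewrite !subSS !subn0 !addn2 !binS !bin1 ?bin0; lia.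
Qed.

Lemma numer_terms_coef (phi : 'I_3 -> nat) j : (J_numerator phi)`_j =
  \sum_(t <- numer_terms (phi 0) (phi 1) (phi 2)) t.1 * (j == t.2)%:Z.
Proof.
rewrite /J_numerator /numer_terms !big_cons big_nil /= !mulr_natl.
rewrite !(coefB, coefD, coefMn, coefXn, coef1).
by rewrite !natz; lia.
Qed.

Lemma standard_count_fps (phi : 'I_3 -> nat) :
  standard_count (phi 0) (phi 1) (phi 2) =1
  fps_div (poly_fps (J_numerator phi)) (poly_fps ((1 - 'X) ^+ 3)).
Proof.
apply: fps_div_uniq.
  by rewrite /poly_fps coef_1subX3.
move=> j; rewrite [RHS]numer_terms_coef /fps_mul /standard_count.
under eq_bigr do rewrite mulr_suml.
rewrite exchange_big; apply: eq_bigr => t _ /=.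
under eq_bigr do rewrite -mulrA.
by rewrite -mulr_sumr; congr (_ * _); apply: dim3_1subX3.
Qed.

(** * Operators between quotients *)

Section HomogDerivations.
Variables (n : nat) (K : fieldType).
Local Notation R := {mpoly K[n]}.

Lemma dhomog_partial k (p : R) :
  p \is k.-homog <-> partial_homog [set: 'I_n] (fun=> 0%N) k p.
Proof.
have sT (m : 'X_{1..n}) : (\sum_(i in [set: 'I_n]) m i)%N = mdeg m.
  by rewrite mdegE; apply: eq_bigl => i; rewrite inE.
split=> [/dhomogP hp m /hp dm | hp].
  by rewrite sT; split=> // i; rewrite inE.
by apply/dhomogP => m /hp[_]; rewrite sT.
Qed.

Lemma dhomog_mderiv k i (p : R) : p \is k.+1.-homog -> mderiv i p \is k.-homog.
Proof.
move/dhomog_partial => hp; apply/dhomog_partial.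
by apply: partial_homog_mderiv => //; rewrite inE.
Qed.

Lemma mderiv_dhomog0 i (p : R) : p \is 0.-homog -> mderiv i p = 0.
Proof. by move/dhomog_partial; apply: mderiv_partial_homog0; rewrite inE. Qed.

Lemma mderivX1 i j : mderiv i ('X_j : R) = (i == j)%:R.
Proof.
have := mderiv_sum_vars K [set j] i; rewrite /sum_vars big_set1 => ->.
by rewrite inE.
Qed.

Definition diff_deriv (i j : 'I_n) : {linear R -> R} :=
  (mderiv i \- mderiv j : R -> R).

Lemma leibniz_diff_deriv i j : leibniz (diff_deriv i j).
Proof. by move=> p q; rewrite /= !mderivM; ring. Qed.

Lemma dhomog_onto (d : {linear R -> R}) i k (g : R) :
    leibniz d -> d 'X_i = 1 ->
    (forall k p, p \is k.+1.-homog -> d p \is k.-homog) ->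
    (forall p, p \is 0.-homog -> d p = 0) ->
    char_above K k.+1 -> g \is k.-homog ->
  exists2 p, p \is k.+1.-homog & d p = g.
Proof.
move=> Ld dX hd hd0 ch hg.
have dg : derivation_graded (fun k p => p \is k.-homog) 'X_i d.
  split=> //= [l a p q hp hq | l p hp]; first by rewrite rpredD // rpredZ.
  by rewrite -add1n dhomogM // dhomogX; apply/eqP/mdeg1.
have [q hq dq] := leibniz_onto (M := 0) Ld dg dX ch hg.
exists ('X_i * q); last by rewrite expr1 mul1r in dq.
by rewrite -add1n dhomogM // dhomogX; apply/eqP/mdeg1.
Qed.

Lemma mderiv_dhomog_onto i k (g : R) : char_above K k.+1 -> g \is k.-homog ->
  exists2 p, p \is k.+1.-homog & mderiv i p = g.
Proof.
apply: (dhomog_onto (leibniz_mderiv i) (i := i)).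
- by rewrite /= mderivX1 eqxx.
- by move=> l p; apply: dhomog_mderiv.
- by move=> p; apply: mderiv_dhomog0.
Qed.

Lemma diff_deriv_dhomog_onto i j k (g : R) : i != j ->
  char_above K k.+1 -> g \is k.-homog ->
  exists2 p, p \is k.+1.-homog & diff_deriv i j p = g.
Proof.
move=> /negbTE nij; apply: (dhomog_onto (@leibniz_diff_deriv i j) (i := i)).
- by rewrite /diff_deriv /= !mderivX1 eqxx eq_sym nij subr0.
- by move=> l p hp; rewrite /= rpredB // dhomog_mderiv.
- by move=> p hp; rewrite /= !mderiv_dhomog0 // subr0.
Qed.

(** [d] maps multiples of [u ^+ M] to multiples of [u ^+ (M - s)]; by truncated
    subtraction this is no condition on the image when [M <= s]. *)
Definition lowers (u : R) (d : R -> R) (s : nat) : Prop :=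
  forall M q, exists q', d (u ^+ M * q) = u ^+ (M - s) * q'.

Lemma leibniz_lowers d u : leibniz d -> lowers u d 1.
Proof.
move=> Ld [|M] q; first by exists (d q); rewrite !mul1r.
exists (d u * q *+ M.+1 + u * d q).
rewrite Ld leibnizX // subn1 /= mulrDr !(mulrnAl, mulrnAr) !mulrA.
by rewrite -exprSr.
Qed.

Lemma leibniz_lowers0 d u : leibniz d -> d u = 0 -> lowers u d 0.
Proof.
move=> Ld du M q; exists (d q); rewrite Ld subn0.
case: M => [|M]; last by rewrite leibnizX // du mulr0 mul0rn mul0r add0r.
rewrite expr0; suff ->: d 1 = 0 by rewrite mul0r add0r.
by apply: (addrI (d 1)); have := Ld 1 1; rewrite !mulr1 mul1r addr0 => <-.
Qed.

Lemma lowers_comp u d1 d2 s1 s2 :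
  lowers u d1 s1 -> lowers u d2 s2 -> lowers u (d2 \o d1) (s1 + s2).
Proof.
move=> h1 h2 M q; have [q1 /= ->] := h1 M q; have [q2 ->] := h2 (M - s1)%N q1.
by exists q2; rewrite subnDA.
Qed.

Lemma mderiv_lowers A i : lowers (sum_vars K A) (mderiv i) (i \in A).
Proof.
have [iA|iA] := boolP (i \in A); first exact/leibniz_lowers/leibniz_mderiv.
apply: leibniz_lowers0; first exact: leibniz_mderiv.
by rewrite mderiv_sum_vars (negbTE iA).
Qed.

Lemma diff_deriv_lowers A i j :
  lowers (sum_vars K A) (diff_deriv i j) ((i \in A) (+) (j \in A)).
Proof.
case E: (_ (+) _); first exact/leibniz_lowers/leibniz_diff_deriv.
apply: leibniz_lowers0; first exact: leibniz_diff_deriv.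
rewrite /= !mderiv_sum_vars; move: E.
by case: (i \in A); case: (j \in A) => // _; rewrite subrr.
Qed.

End HomogDerivations.

(** * Lower bound *)

Section LowerBound.
Variable K : fieldType.
Local Notation R := {mpoly K[3]}.
Local Notation J a b c := (in_ideal_gen (power_gens K a b c)).
Local Notation u A := (sum_vars K A).

Lemma power_ideal_image (f : {linear R -> R}) (s1 s2 s3 a b c a' b' c' : nat) :
    (forall k, lowers (u [set k]) f s1) ->
    (forall k, lowers (u (~: [set k])) f s2) -> lowers (u setT) f s3 ->
    (a - s1 = a')%N -> (2 * b - s2 = 2 * b')%N -> (3 * c - s3 = 3 * c')%N ->
  forall p, J a b c p -> J a' b' c' (f p).
Proof.
move=> l1 l2 l3 aE bE cE p [q ->]; rewrite linear_sum.
apply: (ideal_sum (in_ideal_gen_ideal _)) => i _; rewrite mulrC.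
have: (power_gens K a b c)`_i \in power_gens K a b c by apply: mem_nth.
move: (_`_i) (q i) => g {}q; rewrite power_gensE !inE.
have G1 k : J a' b' c' (f (u [set k] ^+ a * q)).
  have [q' ->] := l1 k a q; rewrite aE /sum_vars big_set1.
  by apply/in_ideal_genMr/power_gens1.
have G2 k : J a' b' c' (f (u (~: [set k]) ^+ (2 * b) * q)).
  by have [q' ->] := l2 k (2 * b)%N q; rewrite bE; apply/in_ideal_genMr/power_gens2.
have G3 : J a' b' c' (f (u setT ^+ (3 * c) * q)).
  by have [q' ->] := l3 (3 * c)%N q; rewrite cE; apply/in_ideal_genMr/power_gens3.
by case/or4P => [/eqP->|/eqP->|/eqP->|/or4P[/eqP->|/eqP->|/eqP->|/eqP->]].
Qed.

Lemma size_monomials3 j : size (monomials 3 j) = dim3 0 j.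
Proof. by rewrite /dim3 /shifted_basis /= subn0. Qed.

Lemma gdim_geq_count a b c j :
  (dim3 0 j <= graded_quotient_dim (J a b c) j
     + (3 * dim3 a j + 3 * dim3 (2 * b) j + dim3 (3 * c) j))%N.
Proof.
have hu A d : (u A) ^+ d \is d.-homog.
  rewrite -[X in X.-homog]mul1n dhomogMn // rpred_sum // => i _.
  by rewrite dhomogX; apply/eqP/mdeg1.
pose ds := [:: a; a; a; 2 * b; 2 * b; 2 * b; 3 * c]%N.
have hd : has_degrees (power_gens K a b c) ds.
  split=> // -[|[|[|[|[|[|[|//]]]]]]] _; rewrite power_gensE; exact: hu.
have := size_monomials_leq_gdim j hd; rewrite size_monomials3.
rewrite /ds !big_cons big_nil -!/(dim3 _ _); lia.
Qed.

(** Dual to multiplying a curve by [x_0 x_1 x_2]: the form [u_A] is lowered by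
    [#|A|]. *)
Lemma gdim_geq_coordinate_lines a b c j : char_above K j -> (3 <= j)%N ->
  (graded_quotient_dim (J a.-1 b.-1 c.-1) (j - 3) <=
   graded_quotient_dim (J a b c) j)%N.
Proof.
move=> ch le3; pose f : {linear R -> R} := mderiv 0 \o (mderiv 1 \o mderiv 2).
have lf A : lowers (u A) f ((2 \in A) + (1 \in A) + (0 \in A)).
  by do ![apply: lowers_comp]; apply: mderiv_lowers.
apply: (leq_gdim_image (f := f)) => [||p|p hp]; try exact: in_ideal_gen_ideal.
  apply: (power_ideal_image (s1 := 1) (s2 := 2) (s3 := 3)); try lia.
  - by move=> k; have := lf [set k]; rewrite !inE; case: (ord3P k) => ->.
  - by move=> k; have := lf (~: [set k]); rewrite !inE; case: (ord3P k) => ->.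
  - by have := lf setT; rewrite !inE.
have [i jE] : exists i, j = i.+3 by exists (j - 3)%N; lia.
rewrite {j le3}jE !subSS subn0 in ch hp *.
have [p1 h1 <-] := mderiv_dhomog_onto 0 (char_aboveW (leqW (leqnSn _)) ch) hp.
have [p2 h2 <-] := mderiv_dhomog_onto 1 (char_aboveW (leqnSn _) ch) h1.
have [p3 h3 <-] := mderiv_dhomog_onto 2 ch h2.
by exists p3.
Qed.

(** Dual to multiplying a curve by the product of the [x_i - x_j].  The operator
    [d_i - d_j] kills [u_A] unless [A] contains exactly one of [i] and [j], so a
    variable is lowered twice, a sum of two variables twice, and the sum of all
    three is left alone. *)
Lemma gdim_geq_diagonal_lines a b c j : char_above K j -> (3 <= j)%N ->
  (graded_quotient_dim (J (a - 2) b.-1 c) (j - 3) <=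
   graded_quotient_dim (J a b c) j)%N.
Proof.
move=> ch le3.
pose f : {linear R -> R} :=
  diff_deriv K 0 1 \o (diff_deriv K 0 2 \o diff_deriv K 1 2).
have lf A : lowers (u A) f (((1 \in A) (+) (2 \in A)) + ((0 \in A) (+) (2 \in A))
                            + ((0 \in A) (+) (1 \in A))).
  by do ![apply: lowers_comp]; apply: diff_deriv_lowers.
apply: (leq_gdim_image (f := f)) => [||p|p hp]; try exact: in_ideal_gen_ideal.
  apply: (power_ideal_image (s1 := 2) (s2 := 2) (s3 := 0)); try lia.
  - by move=> k; have := lf [set k]; rewrite !inE; case: (ord3P k) => ->.
  - by move=> k; have := lf (~: [set k]); rewrite !inE; case: (ord3P k) => ->.
  - by have := lf setT; rewrite !inE.
have [i jE] : exists i, j = i.+3 by exists (j - 3)%N; lia.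
rewrite {j le3}jE !subSS subn0 in ch hp *.
have D i' j' k g := @diff_deriv_dhomog_onto 3 K i' j' k g.
have [p1 h1 <-] := D 0 1 _ _ isT (char_aboveW (leqW (leqnSn _)) ch) hp.
have [p2 h2 <-] := D 0 2 _ _ isT (char_aboveW (leqnSn _) ch) h1.
have [p3 h3 <-] := D 1 2 _ _ isT ch h2.
by exists p3.
Qed.

Definition almost_linear_triple (k a b c : nat) : Prop :=
  (a = b + k \/ a = b + k.+1)%N /\ (b = c + k \/ b = c + k.+1)%N.

(** If [a + b <= j + 1], the coordinate lines are split off.  Otherwise, if
    [2b + c] or [a + 2c] is at most [j], almost linearity makes both at most
    [j + 1] and the diagonal lines are split off, which requires [0 < k]; for
    [k = 0] this case is void.  Otherwise all correction terms of the numerator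
    are of degree larger than [j], and the count of conditions is exact. *)
Lemma standard_count_leq_gdim k a b c j :
  almost_linear_triple k a b c -> char_above K j ->
  (standard_count a b c j <= (graded_quotient_dim (J a b c) j)%:Z)%R.
Proof.
elim/ltn_ind: j k a b c => j IH k a b c alin ch.
have [->|c0] := posnP c; first by rewrite standard_count0.
have [leab lebc] : (b <= a)%N /\ (c <= b)%N by case: alin; lia.
have chj : char_above K (j - 3) by apply: char_aboveW ch; exact: leq_subr.
have [lej|ltj] := leqP (a + b) j.+1.
  have [le3|lt3] := leqP 3 j.
    rewrite standard_count_coordinate_lines //.
    apply: Order.POrderTheory.le_trans (IH _ _ k _ _ _ _ chj) _; first by lia.
      by move: alin; rewrite /almost_linear_triple; lia.
    by rewrite lez_nat; apply: gdim_geq_coordinate_lines.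
  by rewrite -size_standard_monomials // standard_monomials_nil //; lia.
have [lej|ltj'] := leqP (minn (2 * b + c) (a + 2 * c)) j.
  case: k alin => [|k] alin.
    by exfalso; move: alin lej; rewrite /almost_linear_triple; lia.
  rewrite standard_count_diagonal_lines;
    try by move: alin; rewrite /almost_linear_triple; lia.
  apply: Order.POrderTheory.le_trans (IH _ _ k _ _ _ _ chj) _.
  - by move: alin; rewrite /almost_linear_triple; lia.
  - by move: alin; rewrite /almost_linear_triple; lia.
  rewrite lez_nat; apply: gdim_geq_diagonal_lines => //.
  by move: alin; rewrite /almost_linear_triple; lia.
have := gdim_geq_count a b c j.
rewrite /standard_count unlock /= (@dim3_small (a + b)) 1?(@dim3_small (a + b + c));
  try lia.
rewrite (@dim3_small (2 * b + c)) 1?(@dim3_small (a + 2 * c)); lia.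
Qed.

End LowerBound.

Lemma char_above_pchar (K : fieldType) N :
  [pchar K] =i pred0 \/ (exists2 p, p \in [pchar K] & (N < p)%N) ->
  char_above K N.
Proof.
move=> hK i /andP[i0 le_iN]; apply/negP => iK.
case: hK => [K0 | [p pK ltNp]].
  by have [p] := natf0_pchar i0 iK; rewrite K0.
have : (p %| i)%N by rewrite (dvdn_pcharf pK).
by move/(dvdn_leq i0); lia.
Qed.

Theorem corollary5p3 (K : fieldType) (phi : 'I_3 -> nat) :
  almost_linear phi ->
  ([pchar K] =i pred0 \/
   exists2 p : nat, p \in [pchar K] & (phi 0%R + phi 1%R + phi 2%R - 2 < p)%N) ->
  hilbert_series (J_ideal K phi)
    =1 fps_div (poly_fps (J_numerator phi)) (poly_fps ((1 - 'X) ^+ 3)).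
Proof.
move=> [phi0 [k k0 [d01 d12]]] /char_above_pchar ch j.
rewrite -standard_count_fps /hilbert_series.
rewrite -[J_ideal K phi]/(in_ideal_gen (power_gens K (phi 0) (phi 1) (phi 2))).
have alin : almost_linear_triple k (phi 0) (phi 1) (phi 2).
  by move: d01 d12; rewrite !inE /almost_linear_triple; lia.
move: (phi0 2) alin ch; move: (phi 0) (phi 1) (phi 2) => a b c c0 alin ch.
have [leab lebc] : (b <= a)%N /\ (c <= b)%N by case: alin; lia.
have idJ := in_ideal_gen_ideal (power_gens K a b c).
have [ltj|lej] := ltnP j (a + b + c - 2).
  have chj : char_above K j by apply: char_aboveW ch; exact: ltnW.
  apply/eqP; rewrite Order.POrderTheory.eq_le (standard_count_leq_gdim alin chj) andbT.
  rewrite -size_standard_monomials // lez_nat.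
  rewrite -(size_map (fun m => 'X_[m] : {mpoly K[3]})).
  by apply: (gdim_leq_span idJ) => p; apply: standard_span.
rewrite -size_standard_monomials // standard_monomials_nil //.
apply/eqP; rewrite eqz_nat -leqn0.
apply: (gdim_leq_span idJ (gs := [::])) => p hp; apply: in_span_mod.
exact: power_quotient_vanish lej hp.
Qed.
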